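(* Suppose $Q$ is a pentaform and $Q'\subseteq Q$. Then (a) $Q'$ satisfies [Pij], [Pjw], [Pway], [Pay], [Pwy], and [Py]. Thus (b) $Q'$ is a pentaform if and only if it satisfies [Pwa] and [Pr].
   Context: A quintuple $\langle i,j,w,a,y\rangle$ has arbitrary objects as components, called player, situation, decision node, action, successor node. Decision nodes and successor nodes are both nodes (the same object may occur as both). A quintuple set $Q$ is a (possibly infinite) set of quintuples. For a string of letters from $I,J,W,A,Y$, $\pi_{\cdots}(Q)$ is the projection of $Q$ onto those coordinates, in the order listed, e.g. $\pi_{JI}(Q)=\{\langle j,i\rangle\mid \exists w,a,y:\ \langle i,j,w,a,y\rangle\in Q\}$. Write $J=\pi_J(Q)$, $W=\pi_W(Q)$, $Y=\pi_Y(Q)$. For $j\in J$, the slice is $Q_j=\{\langle i_*,j_*,w_*,a_*,y_*\rangle\in Q\mid j_*=j\}$. A function is a set $f$ of couples such that $\langle x,z\rangle,\langle x,z'\rangle\in f$ implies $z=z'$. The axioms for a quintuple set $Q$ are: [Pij] $\pi_{JI}(Q)$ is a function; [Pjw] $\pi_{WJ}(Q)$ is a function; [Pwa] for all $j\in J$, $\pi_{WA}(Q_j)$ is a Cartesian product; [Pway] $\{\langle\langle w,a\rangle,y\rangle\mid\langle w,a,y\rangle\in\pi_{WAY}(Q)\}$ is a function; [Pwy] $\pi_{YW}(Q)$ is a function, denoted $p$; [Pay] $\pi_{YA}(Q)$ is a function; [Py] (given [Pwy]) for every $y\in Y$ there is $m\ge1$ with $p^m(y)\notin Y$ (iterates of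 $p$ from $y$ eventually leave $Y$); [Pr] $W\smallsetminus Y$ is a singleton. A pentaform is a quintuple set satisfying all eight axioms. ''$Q'$ satisfies an axiom'' means the axiom holds with all objects derived from $Q'$ instead of $Q$. *)

(* Defs.v *)
From mathcomp Require Import all_boot.
From mathcomp Require Import classical_sets.

Set Implicit Arguments.
Unset Strict Implicit.
Unset Printing Implicit Defensive.

Local Open Scope classical_set_scope.

(* The five coordinates range over arbitrary types, which may coincide. Decision
   nodes and successor nodes share the type N, since the axioms Py and Pr
   compare them with each other; no other two coordinates are ever compared. *)
Record quintuple (I J N A : Type) := Quintuple {
  player : I;
  situation : J;
  decision : N;
  action : A;
  successor : N }.

Definition is_function (X Z : Type) (f : set (X * Z)) : Prop :=
  forall x z z', f (x, z) -> f (x, z') -> z = z'.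

Definition is_cartesian (X Z : Type) (S : set (X * Z)) : Prop :=
  exists (B : set X) (C : set Z), S = B `*` C.

(* [fpow p m] is p^m, the m-fold composite of the set of couples p. For a
   function p it is again a function, with a couple (y, z) exactly when p^m(y)
   is defined and equal to z. *)
Definition fpow (X : Type) (p : set (X * X)) (m : nat) : set (X * X) :=
  iter m (fun f => (p \; f)%relation) diagonal.

Section Pentaform.
Variables I J N A : Type.
Implicit Types Q : set (quintuple I J N A).

Definition piJ Q : set J := [set situation q | q in Q].
Definition piW Q : set N := [set decision q | q in Q].
Definition piY Q : set N := [set successor q | q in Q].

Definition piJI Q : set (J * I) := [set (situation q, player q) | q in Q].
Definition piWJ Q : set (N * J) := [set (decision q, situation q) | q in Q].
Definition piWA Q : set (N * A) := [set (decision q, action q) | q in Q].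
Definition piYW Q : set (N * N) := [set (successor q, decision q) | q in Q].
Definition piYA Q : set (N * A) := [set (successor q, action q) | q in Q].
Definition piWAY Q : set (N * A * N) :=
  [set (decision q, action q, successor q) | q in Q].

Definition slice Q (j : J) : set (quintuple I J N A) :=
  [set q | Q q /\ situation q = j].

Definition Pij Q : Prop := is_function (piJI Q).
Definition Pjw Q : Prop := is_function (piWJ Q).
Definition Pwa Q : Prop :=
  forall j : J, piJ Q j -> is_cartesian (piWA (slice Q j)).
(* The triple (w, a, y) is by notation the couple ((w, a), y). *)
Definition Pway Q : Prop := is_function (piWAY Q).
Definition Pwy Q : Prop := is_function (piYW Q).
Definition Pay Q : Prop := is_function (piYA Q).
(* Meant in the presence of Pwy, which makes p = piYW Q a function. The
   condition that p^m(y) is not in Y includes that p^m(y) is defined. *)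
Definition Py Q : Prop :=
  forall y : N, piY Q y ->
  exists m : nat, 1 <= m /\ exists z, fpow (piYW Q) m (y, z) /\ ~ piY Q z.
Definition Pr Q : Prop := exists r : N, piW Q `\` piY Q = [set r].

Record pentaform Q : Prop := Pentaform {
  pentaform_Pij : Pij Q;
  pentaform_Pjw : Pjw Q;
  pentaform_Pwa : Pwa Q;
  pentaform_Pway : Pway Q;
  pentaform_Pwy : Pwy Q;
  pentaform_Pay : Pay Q;
  pentaform_Py : Py Q;
  pentaform_Pr : Pr Q }.

End Pentaform.

(* Main.v *)
Require Import Defs.
From mathcomp Require Import all_boot.
From mathcomp Require Import boolp classical_sets.
Local Open Scope classical_set_scope.

(* Only Py needs an argument. Let p' and Y' be the p and Y of Q'. Since p' and p
   agree on Y', an orbit of p' that never leaves Y' is an orbit of p, and hence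
   must leave Y, which contains Y'. *)

(** All inherited axioms but [Py] say that some projection is a function. Projections are monotone
    and a subset of a function is a function, so these pass to [Q']; [Py_sub] handles [Py]. Claim
    (b) is then immediate, [Pwa] and [Pr] being the two axioms left. *)

Lemma is_function_sub (X Z : Type) (f g : set (X * Z)) :
  f `<=` g -> is_function g -> is_function f.
Proof. by move=> fg gf x z z' /fg gz /fg; apply: gf gz. Qed.

Lemma Py_sub (I J N A : Type) (Q Q' : set (quintuple I J N A)) :
  Q' `<=` Q -> Pwy Q -> Py Q -> Py Q'.
Proof.
move=> sub wyQ PyQ y Y'y.
have YY' z : piY Q' z -> piY Q z by apply: image_subset.
have [m [_ [z [pmz nYz]]]] := PyQ y (YY' y Y'y).
apply: contrapT => no_exit.
(* For [k = 0] the point is [y] itself, so [no_exit], which concerns [1 <= m], is needed only for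
   successors. *)
have stay k u : fpow (piYW Q') k (y, u) -> piY Q' u.
  case: k => [yu|k p'ku]; first by rewrite -[u]yu.
  by apply: contrapT => nY'u; apply: no_exit; exists k.+1; split=> //; exists u.
have orbit k u : fpow (piYW Q) k (y, u) -> fpow (piYW Q') k (y, u).
  elim: k u => [//|k IHk] u [v /IHk p'kv pvu]; exists v => //.
  (* As [v] stays in [piY Q'], some [q] in [Q'] has successor [v]; [Pwy Q] forces its decision node
     to be [u], so the last step lies in [piYW Q']. *)
  have [q Q'q qv] := stay _ _ p'kv; move: pvu; rewrite /= -qv => pvu.
  rewrite -(wyQ _ (decision q) u _ pvu); first by exists q.
  by exists q => //; apply: sub.
exact/nYz/YY'/stay/orbit/pmz.
Qed.

Theorem proposition4p1 (I J N A : Type) (Q Q' : set (quintuple I J N A))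
    (hQ : pentaform Q) (hsub : Q' `<=` Q) :
  (Pij Q' /\ Pjw Q' /\ Pway Q' /\ Pay Q' /\ Pwy Q' /\ Py Q') /\
  (pentaform Q' <-> Pwa Q' /\ Pr Q').
Proof.
case: hQ => ij jw _ way wy ay py _.
have sub_fun (X Z : Type) (f : quintuple I J N A -> X * Z) :
    is_function (f @` Q) -> is_function (f @` Q').
  by apply: is_function_sub; apply: image_subset.
have ij' : Pij Q' := sub_fun _ _ _ ij.
have jw' : Pjw Q' := sub_fun _ _ _ jw.
have way' : Pway Q' := sub_fun _ _ _ way.
have wy' : Pwy Q' := sub_fun _ _ _ wy.
have ay' : Pay Q' := sub_fun _ _ _ ay.
have py' : Py Q' := Py_sub _ _ _ _ _ _ hsub wy py.
by split=> //; split=> [[]|[]].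
Qed.
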